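(* Let $f$ be a $\mathbb C^{p\times p}$-valued symmetric discrete analytic function in $\Lambda_{++}=\mathbb N_0+i\mathbb N_0$ such that the generating function $k_f(\lambda,\nu)=\sum_{m,n=0}^\infty f(m,n)\lambda^m\overline{\nu}^n$ converges in a neighborhood of $(0,0)\in\mathbb C^2$. Then there exist a Krein space $\mathfrak K$, a bounded unitary operator $U$ in $\mathfrak K$ and a bounded operator $C$ from $\mathfrak K$ into $\mathbb C^p$ such that $$f(m,n)=C(\sqrt{2}U^{-1}-iI)^m(\sqrt{2}U+iI)^nC^*,\qquad m,n=0,1,\ldots$$
   Context: $f(m,n)=f(m+in)$. $f:\Lambda_{++}\to\mathbb C^{p\times p}$ is discrete analytic if $f(m,n)+if(m+1,n)-if(m,n+1)-f(m+1,n+1)=0$ for all $m,n\in\mathbb N_0$, and symmetric if $f(m,0)=f(0,m)^*$ for all $m\in\mathbb N_0$. A Krein space is a complex vector space $\mathfrak K$ with a Hermitian form $[\cdot,\cdot]$ admitting a direct $[\cdot,\cdot]$-orthogonal decomposition $\mathfrak K=\mathfrak K_+\oplus\mathfrak K_-$ such that $(\mathfrak K_+,[\cdot,\cdot])$ and $(\mathfrak K_-,-[\cdot,\cdot])$ are Hilbert spaces; its topology is that of the Hilbert space obtained by changing the sign of the form on $\mathfrak K_-$. A bounded operator $U$ in $\mathfrak K$ is unitary if it is a bijection with $[Ux,Uy]=[x,y]$ for all $x,y$. $C^*:\mathbb C^p\to\mathfrak K$ denotes the adjoint of $C$ with respect to $[\cdot,\cdot]$ on $\mathfrak K$ and the standard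 inner product of $\mathbb C^p$. *)

(* Defs.v *)
From HB Require Import structures.
From mathcomp Require Import all_boot all_order all_algebra.
From mathcomp Require Import complex.
From mathcomp Require Import all_classical all_reals all_analysis.
From mathcomp Require Import summability.

Set Implicit Arguments.
Unset Strict Implicit.
Unset Printing Implicit Defensive.

Import Order.TTheory GRing.Theory Num.Theory numFieldNormedType.Exports.

Local Open Scope classical_set_scope.
Local Open Scope sesquilinear_scope.
Local Open Scope ring_scope.

Section DiscreteAnalytic.
Context {R : realType} {p : nat}.
Implicit Type f : nat -> nat -> 'M[R[i]]_p.

Definition discrete_analytic f :=
  forall m n : nat,
    f m n + 'i *: f m.+1 n - 'i *: f m n.+1 - f m.+1 n.+1 = 0.

Definition symmetric_da f := forall m : nat, f m 0%N = (f 0%N m)^t*.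

Definition gen_term f (lam nu : R[i]) (mn : nat * nat) : 'M[R[i]^o]_p :=
  (lam ^+ mn.1 * nu^* ^+ mn.2) *: f mn.1 mn.2.

(* Convergence of the double series is unconditional convergence: the net of
   the partial sums over the finite subsets of nat * nat converges.  The
   regular module R[i]^o is what carries the topology of C in the library. *)
Definition gen_fun_cvg f :=
  \forall z \near ((0, 0) : R[i]^o * R[i]^o),
    cvg (partial_sum (gen_term f z.1 z.2) @ totally).

End DiscreteAnalytic.

Section Hilbert.
Context {R : realType} {K : lmodType R[i]}.
Variable h : K -> K -> R[i].

Definition form_norm (x : K) : R[i] := sqrtC (h x x).

Definition form_cauchy (u : nat -> K) :=
  forall e : R[i], 0 < e -> exists N : nat, forall m n : nat,
    (N <= m)%N -> (N <= n)%N -> form_norm (u m - u n) < e.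

Definition form_cvg (u : nat -> K) (l : K) :=
  forall e : R[i], 0 < e -> exists N : nat, forall n : nat,
    (N <= n)%N -> form_norm (u n - l) < e.

Record hilbert_on (S : {pred K}) : Prop := {
  hilbert_submod : submod_closed S;
  hilbert_pos : {in S, forall x, x != 0 -> 0 < h x x};
  hilbert_complete : forall u : nat -> K, (forall n, u n \in S) ->
    form_cauchy u -> exists2 l, l \in S & form_cvg u l }.

End Hilbert.

Record fundamental_decomposition {R : realType} {K : lmodType R[i]}
    (h : K -> K -> R[i]) (Kp Km : {pred K}) : Prop := {
  fd_hilbertp : hilbert_on h Kp;
  fd_hilbertm : hilbert_on (fun x y => - h x y) Km;
  fd_orth : {in Kp & Km, forall x y, h x y = 0};
  fd_sum : forall x, exists y z, [/\ y \in Kp, z \in Km & x = y + z];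
  fd_direct : forall x, x \in Kp -> x \in Km -> x = 0 }.

(* Two fundamental decompositions of the same form give equivalent norms, so
   recording one of them only fixes a norm for the Krein space topology. *)
Record kreinSpace (R : realType) := KreinSpace {
  krein_carrier :> lmodType R[i];
  krein_form : {hermitian krein_carrier for false & Num.conj};
  krein_plus : {pred krein_carrier};
  krein_minus : {pred krein_carrier};
  krein_fd :
    fundamental_decomposition (krein_form : _ -> _ -> R[i])
      krein_plus krein_minus }.

Arguments krein_form {R} k : rename.
Arguments krein_plus {R} k : rename.
Arguments krein_minus {R} k : rename.

Section Krein.
Context {R : realType} {K : kreinSpace R}.

Definition krein_proj (x : K) : K :=
  xget 0 [set y : K | y \in krein_plus K /\ x - y \in krein_minus K].

Definition krein_hilbert_form (x y : K) : R[i] :=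
  krein_form K (krein_proj x) (krein_proj y)
  - krein_form K (x - krein_proj x) (y - krein_proj y).

Definition krein_norm (x : K) : R[i] := form_norm krein_hilbert_form x.

Definition krein_bounded (U : K -> K) :=
  exists M : R[i], forall x, krein_norm (U x) <= M * krein_norm x.

Record krein_unitary (U : {linear K -> K}) : Prop := {
  unitary_bounded : krein_bounded U;
  unitary_bij : bijective U;
  unitary_form : forall x y, krein_form K (U x) (U y) = krein_form K x y }.

Context {p : nat}.

Definition cdot (a b : 'cV[R[i]]_p) : R[i] := \sum_(i < p) a i 0 * (b i 0)^*.

Definition krein_out_bounded (C : K -> 'cV[R[i]]_p) :=
  exists M : R[i], forall x, form_norm cdot (C x) <= M * krein_norm x.

Definition krein_adjoint (C : K -> 'cV[R[i]]_p) (Cs : 'cV[R[i]]_p -> K) :=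
  forall (x : K) (a : 'cV[R[i]]_p), cdot (C x) a = krein_form K x (Cs a).

End Krein.

(* Main.v *)
Require Import Defs.
From HB Require Import structures.
From mathcomp Require Import all_boot all_order all_algebra.
From mathcomp Require Import complex.
From mathcomp Require Import all_classical all_reals all_analysis.
From mathcomp Require Import finmap summability.
From mathcomp Require Import ring lra.

(** Write A = sqrt 2 U^-1 - i and B = sqrt 2 U + i.  The identity
    A B = 1 + i A - i B holds for every invertible U, and it is the recurrence
    of discrete analyticity read on m, n |-> C A^m B^n C^*.  When U is unitary
    for the indefinite form, A is the adjoint of B, so that this function is
    also symmetric.  A symmetric discrete analytic function is determined by
    its values f(0,n), hence only the identities f(0,n) = C B^n C^* matter
    ([realization]).  Solving B = sqrt 2 U + i for U, they amount to
    C U^k C^* = c_k for k >= 0, where c_k is the value at 0 of the k-th power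
    of (E - i) / sqrt 2 applied to f(0,.), E being the shift of sequences
    ([iterated_moment]).

    Convergence of the generating function bounds f(0,n), and therefore c_k,
    by a geometric sequence ([gen_fun_growth], [iterated_moment_growth]).
    Moreover c_0 = f(0,0) is Hermitian by symmetry.  Any such moment sequence
    is realized explicitly: the Krein space is the sum of two copies of
    l2(Z, C^p) with the hyperbolic form
      [(x, y), (x', y')] = <x, y'> + <y, x'>,
    and U is r S on the first copy and r^-1 S on the second one, S being the
    bilateral shift; the two weights cancel in the form, so U is unitary
    ([wcomp_unitary]).  With C^* a = (delta_0 a, sum_n r^-n delta_n d_n^* a)
    the entry [U^k C^* a, C^* b] picks out the single matrix d_k, up to the
    term k = 0 which is counted twice ([bishift_moments]); thus d_0 = c_0 / 2
    and d_k = c_k otherwise.  The vector C^* a is square summable as soon as r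
    exceeds the growth rate of the moments.

    The two copies are indexed together, so that the space is a single l2(I)
    and the form is <x, J y> for an involution J of I; the eigenspaces of J are
    a fundamental decomposition whose Hilbert norm is the l2 norm
    ([reflection_fd], [reflection_krein_norm]). *)

Set Implicit Arguments.
Unset Strict Implicit.
Unset Printing Implicit Defensive.

Import Order.TTheory GRing.Theory Num.Theory numFieldNormedType.Exports.
Local Open Scope classical_set_scope.
Local Open Scope sesquilinear_scope.
Local Open Scope ring_scope.

#[local] Existing Instance totally_filter.

(** * Unconditional sums of complex families *)

Section RealAndImaginaryParts.
Context {R : realType}.
Implicit Types z : R[i].
Local Open Scope complex_scope.

Lemma gtc0_real (e : R[i]) : 0 < e -> exists2 d : R, 0 < d & e = d%:C.
Proof.
move=> e0; have er : e \is Num.real by apply: ger0_real; exact: ltW.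
exists (complex.Re e); last by rewrite RRe_real.
by rewrite -ltcR RRe_real.
Qed.

Lemma norm_real_complex (c : R) : `|c%:C| = `|c|%:C.
Proof. by rewrite normc_def /= expr0n addr0 sqrtr_sqr. Qed.

Lemma norm_imaginary_unit : `|'i%C : R[i]| = 1.
Proof. by rewrite normc_def /= expr0n expr1n add0r sqrtr1. Qed.

Lemma normc_ge_Im z : `|complex.Im z|%:C <= `|z|.
Proof.
have := normc_ge_Re (z * 'i%C); rewrite ReiNIm normrN normrM.
by rewrite norm_imaginary_unit mulr1.
Qed.

Lemma cvg_real_complex {T : Type} {F : set_system T} {FF : Filter F}
    (g : T -> R) (l : R) :
  g @ F --> l -> ((fun t => (g t)%:C) : T -> R[i]^o) @ F --> (l%:C : R[i]^o).
Proof.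
move=> gl; apply/cvgrPdist_lt => _ /gtc0_real[d d0 ->].
move/cvgrPdist_lt : gl => /(_ d d0); apply: filterS => t.
by rewrite -rmorphB norm_real_complex ltcR.
Qed.

End RealAndImaginaryParts.

Section ComplexSums.
Context {R : realType} {I : choiceType}.
Implicit Types (u : I -> R[i]) (A B : {fset I}).
Local Open Scope complex_scope.

Definition abs_summable u :=
  exists M : R[i], forall A, \sum_(i <- A) `|u i| <= M.

Definition psum u A : R[i]^o := \sum_(i <- A) u i.

(** The sum is the limit along the net of finite subsets: invariance under
    permutations of the indices is then immediate, which is what makes the
    shift below unitary. *)
Definition csum u : R[i] := lim (psum u @ totally).

Lemma fset_sub_sep A B : (A `<=` B)%fset -> [fset x in B | x \in A]%fset = A.
Proof.
move=> AB; apply/fsetP => x; rewrite !inE /= andbC; case xA: (x \in A) => //=.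
exact: (fsubsetP AB).
Qed.

Lemma sumr_fsetS (v : I -> R) A B : (forall i, 0 <= v i) -> (A `<=` B)%fset ->
  \sum_(i <- A) v i <= \sum_(i <- B) v i.
Proof.
move=> v0 AB; rewrite [leRHS](big_fsetID _ (mem A)) /= fset_sub_sep //.
by rewrite lerDl sumr_ge0.
Qed.

Lemma cvg_psum_ge0 (v : I -> R) M : (forall i, 0 <= v i) ->
  (forall A, \sum_(i <- A) v i <= M) ->
  cvg ((fun A => \sum_(i <- A) v i) @ totally).
Proof.
move=> v0 vM; set s := (fun A => _).
pose S := [set s A | A in setT]%classic.
have supS : has_sup S.
  split; first by exists (s fset0), fset0.
  by exists M => _ [A _ <-]; exact: vM.
apply/cvg_ex; exists (sup S); apply/cvgrPdist_lt => e e0.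
have [_ [A _ <-] hA] := sup_adherent e0 supS.
exists A => // B /= AB.
have sB : s B <= sup S by apply: sup_upper_bound => //; exists B.
rewrite ger0_norm ?subr_ge0 // ltrBlDr -ltrBlDl.
by apply: lt_le_trans hA _; exact: sumr_fsetS.
Qed.

Lemma cvg_psum_real (v : I -> R) M :
  (forall A, \sum_(i <- A) `|v i| <= M) ->
  cvg ((fun A => \sum_(i <- A) v i) @ totally).
Proof.
move=> vM.
(* v = (v + |v|) - |v| is a difference of two nonnegative families. *)
have -> : (fun A => \sum_(i <- A) v i) =
    (fun A => \sum_(i <- A) (v i + `|v i|) - \sum_(i <- A) `|v i|).
  by apply/funext => A; rewrite big_split /= addrK.
apply: is_cvgB; last exact: cvg_psum_ge0 vM.
apply: (@cvg_psum_ge0 _ (M + M)) => [i|A].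
  by have := ler_norm (- v i); rewrite normrN; lra.
rewrite big_split /= lerD //; apply: le_trans (vM A).
by apply: ler_sum => i _; exact: ler_norm.
Qed.

(** Completeness of the field of complex numbers is used here through real and
    imaginary parts, whose partial sums are differences of bounded monotone
    nets. *)
Lemma abs_summable_cvg u : abs_summable u -> cvg (psum u @ totally).
Proof.
move=> [M uM].
have Mr : 0 <= M by have := uM fset0; rewrite big_seq_fset0.
have Re_le (z : R[i]) : `|complex.Re z| <= complex.Re `|z|.
  by rewrite -lecR RRe_real ?normr_real // normc_ge_Re.
have Im_le (z : R[i]) : `|complex.Im z| <= complex.Re `|z|.
  by rewrite -lecR RRe_real ?normr_real // normc_ge_Im.
have sRe A : \sum_(i <- A) complex.Re `|u i| <= complex.Re M.
  rewrite -lecR RRe_real ?ger0_real // rmorph_sum.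
  rewrite (eq_bigr (fun i => `|u i|)) => [|i _]; first exact: uM.
  exact: RRe_real (normr_real _).
have cRe : cvg ((fun A => \sum_(i <- A) complex.Re (u i)) @ totally).
  apply: (@cvg_psum_real _ (complex.Re M)) => A; apply: le_trans (sRe A).
  by apply: ler_sum => i _.
have cIm : cvg ((fun A => \sum_(i <- A) complex.Im (u i)) @ totally).
  apply: (@cvg_psum_real _ (complex.Re M)) => A; apply: le_trans (sRe A).
  by apply: ler_sum => i _.
have -> : psum u = (fun A => (\sum_(i <- A) complex.Re (u i))%:C
    + 'i * (\sum_(i <- A) complex.Im (u i))%:C : R[i]^o).
  apply/funext => A; rewrite /psum !rmorph_sum mulr_sumr -big_split /=.
  by apply: eq_bigr => i _; rewrite -complexE.
apply: is_cvgD.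
  by move/cvg_ex : cRe => [l /cvg_real_complex ?]; apply/cvg_ex; exists l%:C.
apply: is_cvgMl_tmp.
by move/cvg_ex : cIm => [l /cvg_real_complex ?]; apply/cvg_ex; exists l%:C.
Qed.

End ComplexSums.

Section ComplexSumsTheory.
Context {R : realType} {I : choiceType}.
Implicit Types (u v : I -> R[i]) (A B : {fset I}).
Local Open Scope complex_scope.

Lemma csum_lim u (l : R[i]^o) : psum u @ totally --> l -> csum u = l.
Proof. exact: cvg_lim. Qed.

Lemma csum_cvg u : abs_summable u -> psum u @ totally --> (csum u : R[i]^o).
Proof. by move/abs_summable_cvg. Qed.

Lemma csumD u v : abs_summable u -> abs_summable v ->
  csum (fun i => u i + v i) = csum u + csum v.
Proof.
move=> /csum_cvg su /csum_cvg sv.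
have E : psum (fun i => u i + v i) = (fun A => psum u A + psum v A : R[i]^o).
  by apply/funext => A; rewrite /psum big_split.
rewrite /csum E; exact: (cvg_lim _ (cvgD su sv)).
Qed.

Lemma csumZ c u : abs_summable u -> csum (fun i => c * u i) = c * csum u.
Proof.
move=> /csum_cvg su.
have E : psum (fun i => c * u i) = (fun A => c *: (psum u A : R[i]^o)).
  by apply/funext => A; rewrite /psum scaler_sumr.
rewrite /csum E; exact: (cvg_lim _ (cvgZl_tmp su)).
Qed.

Lemma csum_conj u : abs_summable u -> csum (fun i => (u i)^*%R) = (csum u)^*%R.
Proof.
move=> /csum_cvg su; apply: csum_lim; apply/cvgrPdist_lt => e e0.
move/cvgrPdist_lt : su => /(_ e e0); apply: filterS => A.
rewrite (_ : psum (fun i => (u i)^*%R) A = (psum u A : R[i])^*%R); last first.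
  by rewrite /psum rmorph_sum.
by rewrite -rmorphB norm_conjC.
Qed.

Lemma csum_fin u A : (forall i, i \notin A -> u i = 0) ->
  csum u = \sum_(i <- A) u i.
Proof.
move=> u0; apply: csum_lim; apply: (@cvg_near_cst _ R[i]^o).
exists A => // B /= AB; rewrite /psum (big_fsetID _ (mem A)) /= fset_sub_sep //.
have -> : \sum_(i <- [fset x in B | x \notin A]%fset) u i = 0.
  by rewrite big_seq big1 // => i; rewrite !inE => /andP[_ /u0].
by rewrite addr0.
Qed.

Lemma csum_reindex (s t : I -> I) u : cancel s t -> cancel t s ->
  abs_summable u -> csum (fun i => u (s i)) = csum u.
Proof.
move=> st ts /csum_cvg su; apply: csum_lim.
have -> : psum (fun i => u (s i)) = psum u \o (fun A => [fset s i | i in A]%fset).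
  apply/funext => A; rewrite /psum /= big_imfset //=.
  by move=> x y _ _ /(can_inj st).
apply: cvg_comp su => P [A _ AP]; exists [fset t i | i in A]%fset => // B /= tAB.
apply: AP => /=; apply/fsubsetP => i iA; apply/imfsetP; exists (t i); last by rewrite ts.
by apply: (fsubsetP tAB); apply/imfsetP; exists i.
Qed.

(** The sum of a nonnegative family is the supremum of its finite sums.  The
    order of the complex numbers being partial, the comparison is carried out
    on real parts. *)
Lemma csum_ge0_bounds u (M : R[i]) : (forall i, 0 <= u i) ->
  (forall A, \sum_(i <- A) u i <= M) ->
  csum u <= M /\ forall A, \sum_(i <- A) u i <= csum u.
Proof.
move=> u0 uM; pose v i := complex.Re (u i).
have uv i : u i = (v i)%:C by rewrite RRe_real // ger0_real.
have v0 i : 0 <= v i by rewrite -ler0c -uv.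
have M0 : 0 <= M by have := uM fset0; rewrite big_seq_fset0.
have ME : M = (complex.Re M)%:C by rewrite RRe_real // ger0_real.
have uvA A : \sum_(i <- A) u i = (\sum_(i <- A) v i)%:C.
  by rewrite rmorph_sum; exact: eq_bigr.
have vM A : \sum_(i <- A) v i <= complex.Re M.
  by rewrite -lecR -ME -uvA.
have cv := cvg_psum_ge0 v0 vM.
have -> : csum u = (lim ((fun A => \sum_(i <- A) v i) @ totally))%:C.
  apply: csum_lim; rewrite (_ : psum u = fun A => (\sum_(i <- A) v i)%:C).
    exact: cvg_real_complex.
  by apply/funext => A; rewrite /psum uvA.
split=> [|A].
  by rewrite ME lecR; apply: limr_le => //; exact: nearW.
rewrite uvA lecR; apply: limr_ge => //; exists A => // B /=; exact: sumr_fsetS.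
Qed.

End ComplexSumsTheory.

(** * The Hilbert space of square summable families *)

Section SquareSummable.
Context {R : realType} {I : choiceType}.
Implicit Types (x y : I -> R[i]) (A : {fset I}).

Definition sq_summable x :=
  exists M : R[i], forall A, \sum_(i <- A) `|x i| ^+ 2 <= M.

Lemma sqr_normr_sub_ge0 (a b : R[i]) : 0 <= (`|a| - `|b|) ^+ 2.
Proof. by rewrite real_exprn_even_ge0 // realB ?normr_real. Qed.

Lemma sqr_normrD_le (a b : R[i]) :
  `|a + b| ^+ 2 <= `|a| ^+ 2 *+ 2 + `|b| ^+ 2 *+ 2.
Proof.
have : `|a + b| ^+ 2 <= (`|a| + `|b|) ^+ 2.
  by rewrite ler_pXn2r ?nnegrE ?addr_ge0 // ler_normD.
move/le_trans; apply; rewrite -subr_ge0.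
by rewrite (_ : _ - _ = (`|a| - `|b|) ^+ 2) ?sqr_normr_sub_ge0 //; ring.
Qed.

Lemma normrM_le_sqr (a b : R[i]) : `|a * b| <= `|a| ^+ 2 + `|b| ^+ 2.
Proof.
rewrite normrM -subr_ge0.
rewrite (_ : _ - _ = (`|a| - `|b|) ^+ 2 + `|a| * `|b|); last by ring.
by rewrite addr_ge0 ?sqr_normr_sub_ge0 // mulr_ge0.
Qed.

Lemma sq_summable_mul x y : sq_summable x -> sq_summable y ->
  abs_summable (fun i => x i * (y i)^*).
Proof.
move=> [M xM] [N yN]; exists (M + N) => A.
apply: (@le_trans _ _ (\sum_(i <- A) (`|x i| ^+ 2 + `|y i| ^+ 2))).
  by apply: ler_sum => i _; rewrite -(norm_conjC (y i)) normrM_le_sqr.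
by rewrite big_split lerD.
Qed.

Definition l2_pred : {pred I -> R[i]} := fun x => `[< sq_summable x >].

Lemma l2_submod : submod_closed l2_pred.
Proof.
split=> [|a x y /asboolP[M xM] /asboolP[N yN]]; apply/asboolP.
  by exists 0 => A; rewrite big1 // => i _; rewrite /= normr0 expr0n.
exists (`|a| ^+ 2 * M *+ 2 + N *+ 2) => A.
apply: (@le_trans _ _ (\sum_(i <- A) (`|a| ^+ 2 * `|x i| ^+ 2 *+ 2 + `|y i| ^+ 2 *+ 2))).
  apply: ler_sum => i _; rewrite -exprMn -normrM; exact: sqr_normrD_le.
rewrite big_split lerD // sumrMnl ler_wMn2r //= -mulr_sumr.
by rewrite ler_wpM2l ?exprn_ge0.
Qed.

HB.instance Definition _ := GRing.isSubmodClosed.Build _ _ l2_pred l2_submod.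

Record l2 := L2 { l2_fun :> I -> R[i]; l2P : l2_fun \in l2_pred }.

HB.instance Definition _ := [isSub for l2_fun].
HB.instance Definition _ := [Choice of l2 by <:].
HB.instance Definition _ := [SubChoice_isSubLmodule of l2 by <:].

End SquareSummable.
Arguments l2 R I : clear implicits.

Section L2Theory.
Context {R : realType} {I : choiceType}.
Local Notation H := (l2 R I).
Implicit Types (x y z : H) (A : {fset I}).

Lemma l2_sq_summable x : sq_summable x.
Proof. exact/asboolP/(l2P x). Qed.

Lemma l2_eq x y : (forall i, x i = y i) -> x = y.
Proof. by move=> xy; apply/val_inj/funext. Qed.

Lemma l2DE x y i : (x + y) i = x i + y i. Proof. by []. Qed.
Lemma l2BE x y i : (x - y) i = x i - y i. Proof. by []. Qed.
Lemma l2ZE a x i : (a *: x) i = a * x i. Proof. by []. Qed.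

Definition l2dot x y : R[i] := csum (fun i => x i * (y i)^*).

Lemma l2dot_summable x y : abs_summable (fun i => x i * (y i)^*).
Proof. exact: sq_summable_mul (l2_sq_summable x) (l2_sq_summable y). Qed.

Lemma l2dotP a x y z : l2dot (a *: x + y) z = a * l2dot x z + l2dot y z.
Proof.
rewrite /l2dot -csumZ; last exact: l2dot_summable.
rewrite -csumD; first by congr csum; apply/funext => i; rewrite l2DE l2ZE mulrDl mulrA.
  have [M xM] := l2dot_summable (a *: x) z; exists M => A.
  by under eq_bigr do rewrite mulrA.
exact: l2dot_summable.
Qed.

Lemma l2dotC x y : l2dot x y = (l2dot y x)^*.
Proof.
rewrite /l2dot -csum_conj; last exact: l2dot_summable.
by congr csum; apply/funext => i; rewrite rmorphM /= conjCK mulrC.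
Qed.

Lemma l2dot_sqr x : l2dot x x = csum (fun i => `|x i| ^+ 2).
Proof. by congr csum; apply/funext => i; rewrite normCK. Qed.

Lemma l2dot_partial x A : \sum_(i <- A) `|x i| ^+ 2 <= l2dot x x.
Proof.
have [M xM] := l2_sq_summable x; rewrite l2dot_sqr.
by have [_] := csum_ge0_bounds (fun i => exprn_ge0 2 (normr_ge0 (x i))) xM.
Qed.

Lemma l2dot_le x M : (forall A, \sum_(i <- A) `|x i| ^+ 2 <= M) -> l2dot x x <= M.
Proof.
move=> xM; rewrite l2dot_sqr.
by have [] := csum_ge0_bounds (fun i => exprn_ge0 2 (normr_ge0 (x i))) xM.
Qed.

Lemma l2dot_coord x i : `|x i| ^+ 2 <= l2dot x x.
Proof. by have := l2dot_partial x [fset i]%fset; rewrite big_seq_fset1. Qed.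

Lemma l2dot_ge0 x : 0 <= l2dot x x.
Proof. by have := l2dot_partial x fset0; rewrite big_seq_fset0. Qed.

Lemma l2dot_gt0 x : x != 0 -> 0 < l2dot x x.
Proof.
move=> x0; rewrite lt_def l2dot_ge0 andbT; apply: contra x0 => /eqP xx0.
apply/eqP/l2_eq => i; apply/eqP; rewrite -normr_eq0 -sqrf_eq0 eq_le exprn_ge0 // andbT.
by rewrite -xx0 l2dot_coord.
Qed.

End L2Theory.

Section Completeness.
Context {R : realType}.
Local Open Scope complex_scope.

Lemma complex_cauchy (z : nat -> R[i]) :
  (forall e : R[i], 0 < e -> exists N, forall m n, (N <= m)%N -> (N <= n)%N ->
    `|z m - z n| < e) ->
  exists l, forall e : R[i], 0 < e -> exists N, forall n, (N <= n)%N ->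
    `|z n - l| < e.
Proof.
move=> zC.
have real_cauchy (v : nat -> R) : (forall m n, (`|v m - v n|)%:C <= `|z m - z n|) ->
    cvg (v @ \oo).
  move=> vz; apply/cauchy_cvgP/cauchy_exP => e e0.
  have e0' : 0 < e%:C by rewrite ltcR.
  have [N hN] := zC _ e0'; exists (v N); exists N => // n /= Nn.
  by rewrite /ball /= -ltcR; apply: le_lt_trans (vz _ _) (hN _ _ _ _).
have cRe : cvg ((fun n => complex.Re (z n)) @ \oo).
  by apply: real_cauchy => m n; move: (normc_ge_Re (z m - z n)); case: (z m); case: (z n).
have cIm : cvg ((fun n => complex.Im (z n)) @ \oo).
  by apply: real_cauchy => m n; move: (normc_ge_Im (z m - z n)); case: (z m); case: (z n).
move/cvg_ex : cRe => [a /cvgrPdist_lt ca].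
move/cvg_ex : cIm => [b /cvgrPdist_lt cb].
exists (a +i* b) => _ /gtc0_real[d d0 ->].
have d20 : 0 < d / 2 by rewrite divr_gt0.
have [N _ hN] := ca _ d20; have [N' _ hN'] := cb _ d20.
exists (maxn N N') => n; rewrite geq_max => /andP[Nn N'n].
have -> : z n - a +i* b =
    (complex.Re (z n) - a)%:C + 'i%C * (complex.Im (z n) - b)%:C.
  by case: (z n) => x y; simpc.
apply: le_lt_trans (ler_normD _ _) _; rewrite normrM !norm_real_complex.
rewrite norm_imaginary_unit mul1r.
rewrite -rmorphD ltcR [d]splitr ltrD // distrC; [exact: hN | exact: hN'].
Qed.

Context {I : choiceType}.
Local Notation H := (l2 R I).
Implicit Types (x y : H) (A : {fset I}).

Lemma form_norm_lt (x : H) (e : R[i]) : 0 < e ->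
  (form_norm l2dot x < e) = (l2dot x x < e ^+ 2).
Proof.
move=> e0; rewrite -(ltr_pXn2r (n := 2)) ?nnegrE ?sqrtC_ge0 ?l2dot_ge0 ?(ltW e0) //.
by rewrite sqrtCK.
Qed.

Lemma sum_sqr_dist_cvg (z : nat -> I -> R[i]) (l : I -> R[i]) (s : seq I) :
  (forall i e, 0 < e -> exists N, forall n, (N <= n)%N -> `|z n i - l i| < e) ->
  forall e : R[i], 0 < e -> exists N, forall n, (N <= n)%N ->
    \sum_(i <- s) `|z n i - l i| ^+ 2 < e.
Proof.
move=> zl; elim: s => [|i s IH] e e0; first by exists 0%N => n _; rewrite big_nil.
have e20 : 0 < e / 2 by rewrite divr_gt0.
have [N hN] := IH _ e20.
have s20 : 0 < sqrtC (e / 2) by rewrite sqrtC_gt0.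
have [N' hN'] := zl i _ s20.
exists (maxn N N') => n; rewrite geq_max => /andP[Nn N'n].
rewrite big_cons [e]splitr ltrD ?hN // -[X in _ < X]sqrtCK.
by rewrite ltr_pXn2r ?nnegrE ?(ltW s20) // hN'.
Qed.

(** A Cauchy sequence converges coordinatewise.  A finite sum of the |u_m - l|^2
    is compared with that of the |u_m - u_n|^2 for an n that may depend on the
    finite set; the resulting bound does not, so it passes to the full sum. *)
Lemma l2_complete (u : nat -> H) : form_cauchy l2dot u ->
  exists l, form_cvg l2dot u l.
Proof.
move=> uC.
have coord i : exists l, forall e : R[i], 0 < e -> exists N, forall n, (N <= n)%N ->
    `|u n i - l| < e.
  apply: (@complex_cauchy (fun n => u n i)) => e e0; have [N hN] := uC _ e0.
  exists N => m n Nm Nn; have := hN m n Nm Nn; rewrite form_norm_lt // => h.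
  rewrite -(ltr_pXn2r (n := 2)) ?nnegrE ?(ltW e0) //.
  exact: le_lt_trans (l2dot_coord (u m - u n) i) h.
have {coord} [l hl] := choice coord.
have tail e : 0 < e -> exists N, forall m A, (N <= m)%N ->
    \sum_(i <- A) `|u m i - l i| ^+ 2 <= e ^+ 2 *+ 4.
  move=> e0; have [N hN] := uC _ e0; exists N => m A Nm.
  have e20 : 0 < e ^+ 2 by rewrite exprn_gt0.
  have [N' hN'] := sum_sqr_dist_cvg A hl e20.
  pose n := maxn N N'.
  apply: (@le_trans _ _ (\sum_(i <- A) (`|u m i - u n i| ^+ 2 *+ 2
      + `|u n i - l i| ^+ 2 *+ 2))).
    by apply: ler_sum => i _; rewrite -[u m i](subrK (u n i)) -addrA addrK;
       exact: sqr_normrD_le.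
  rewrite big_split /= !sumrMnl (_ : e ^+ 2 *+ 4 = e ^+ 2 *+ 2 + e ^+ 2 *+ 2); last first.
    by rewrite -mulrnDr.
  rewrite lerD // lerMn2r /=.
    apply: le_trans (l2dot_partial (u m - u n) A) _.
    by apply: ltW; rewrite -form_norm_lt // hN // leq_maxl.
  by apply: ltW; apply: hN'; rewrite leq_maxr.
have [N0 hN0] := tail 1 ltr01.
have lP : l \in l2_pred.
  have -> : l = (u N0 : I -> R[i]) - ((u N0 : I -> R[i]) - l) by rewrite subKr.
  apply: rpredB; first exact: l2P.
  by apply/asboolP; exists (1 ^+ 2 *+ 4) => A; exact: hN0.
exists (L2 lP) => e e0.
(* The bound of [tail] at e / 3 is (4/9) e^2 < e^2. *)
have e30 : 0 < e / 3 by rewrite divr_gt0.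
have [N hN] := tail _ e30; exists N => n Nn; rewrite form_norm_lt //.
apply: (@le_lt_trans _ _ ((e / 3) ^+ 2 *+ 4)).
  by apply: l2dot_le => A; exact: hN.
rewrite expr_div_n -[_ *+ 4]mulr_natr -mulrA gtr_pMr ?exprn_gt0 //.
rewrite mulrC ltr_pdivrMr ?exprn_gt0 // mul1r -natrX ltr_nat //.
Qed.

End Completeness.

Section InnerProduct.
Context {R : realType} {I : choiceType}.
Local Notation H := (l2 R I).
Implicit Types (x y z : H).

Lemma l2dot_bilinear : bilinear_for
  (GRing.Scale.Law.clone _ _ *%R _) (GRing.Scale.Law.clone _ _ (Num.conj \; *%R) _)
  (@l2dot R I).
Proof.
split=> [z a x y|x a y z]; first exact: l2dotP.
by rewrite l2dotC l2dotP rmorphD rmorphM /= -!l2dotC.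
Qed.

HB.instance Definition _ :=
  bilinear_isBilinear.Build _ H H _ *%R (Num.conj \; *%R) (@l2dot R I) l2dot_bilinear.

Lemma l2dot_hermitian x y : l2dot x y = (-1) ^+ false * (l2dot y x)^*.
Proof. by rewrite mul1r l2dotC. Qed.

HB.instance Definition _ :=
  isHermitianSesquilinear.Build _ _ false Num.conj (@l2dot R I) l2dot_hermitian.

Lemma l2dot_CauchySchwarz x y : `|l2dot x y| ^+ 2 <= l2dot x x * l2dot y y.
Proof.
have [->|y0] := eqVneq y 0; first by rewrite !linear0r normr0 expr0n lexx.
have yy := l2dot_gt0 y0.
(* The square of the norm of d x - t y is d (<x, x> d - |t|^2). *)
set t := l2dot x y; set d := l2dot y y.
have := l2dot_ge0 (d *: x - t *: y).
rewrite linearBl !linearBr !linearZl_LR !linearZr_LR /= -/t -/d (l2dotC y x) -/t.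
have -> : d^* = d by apply: CrealP; exact: ger0_real (ltW yy).
rewrite (_ : _ - _ = d * (l2dot x x * d - `|t| ^+ 2)).
  by rewrite pmulr_rge0 // subr_ge0.
rewrite normCK; ring.
Qed.

End InnerProduct.

(** * Weighted composition operators *)

Section WeightedComposition.
Context {R : realType} {I : choiceType}.
Local Notation H := (l2 R I).
Variables (w : I -> R[i]) (s : I -> I) (c : R[i]).
Hypotheses (c_ge0 : 0 <= c) (w_le : forall i, `|w i| <= c) (s_inj : injective s).
Implicit Types (x y : H) (A : {fset I}).

Lemma wcomp_partial x A : \sum_(i <- A) `|w i * x (s i)| ^+ 2 <= c ^+ 2 * l2dot x x.
Proof.
apply: (@le_trans _ _ (\sum_(i <- A) c ^+ 2 * `|x (s i)| ^+ 2)).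
  apply: ler_sum => i _; rewrite normrM exprMn ler_wpM2r ?exprn_ge0 //.
  by rewrite ler_pXn2r // nnegrE.
rewrite -mulr_sumr ler_wpM2l ?exprn_ge0 //.
apply: le_trans (l2dot_partial x [fset s i | i in A]%fset).
by rewrite big_imfset //= => i j _ _; exact: s_inj.
Qed.

Lemma wcomp_l2 x : (fun i => w i * x (s i)) \in l2_pred.
Proof. by apply/asboolP; exists (c ^+ 2 * l2dot x x) => A; exact: wcomp_partial. Qed.

Definition wcomp x : H := L2 (wcomp_l2 x).

Lemma wcompE x i : wcomp x i = w i * x (s i). Proof. by []. Qed.

Lemma wcomp_is_linear : linear wcomp.
Proof. by move=> a x y; apply: l2_eq => i; rewrite !(wcompE, l2DE, l2ZE); ring. Qed.

HB.instance Definition _ := GRing.isLinear.Build _ _ _ _ wcomp wcomp_is_linear.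

Lemma wcomp_bounded x : form_norm l2dot (wcomp x) <= c * form_norm l2dot x.
Proof.
rewrite -(ler_pXn2r (n := 2)) ?nnegrE ?mulr_ge0 ?sqrtC_ge0 ?l2dot_ge0 //.
rewrite exprMn !sqrtCK; apply: l2dot_le => A; exact: wcomp_partial.
Qed.

End WeightedComposition.

(** * The Krein space of an involution of the index set *)

Section KreinOfInvolution.
Context {R : realType} {I : choiceType}.
Local Notation H := (l2 R I).
Variables (J : I -> I) (JK : involutive J).
Implicit Types (x y z : H) (A : {fset I}).

Let w1 (i : I) : `|1 : R[i]| <= 1. Proof. by rewrite normr1. Qed.

Definition reflection : {linear H -> H} :=
  wcomp ler01 w1 (inv_inj JK).

Lemma reflectionE x i : reflection x i = x (J i).
Proof. exact: mul1r. Qed.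

Lemma reflectionK : involutive reflection.
Proof. by move=> x; apply: l2_eq => i; rewrite !reflectionE JK. Qed.

Lemma l2dot_reflection x y : l2dot (reflection x) y = l2dot x (reflection y).
Proof.
rewrite -[in LHS](reflectionK y) /l2dot -(csum_reindex JK JK (l2dot_summable x _)).
by congr csum; apply/funext => i; rewrite !reflectionE.
Qed.

Definition jform x y : R[i] := l2dot x (reflection y).

Lemma jform_bilinear : bilinear_for
  (GRing.Scale.Law.clone _ _ *%R _) (GRing.Scale.Law.clone _ _ (Num.conj \; *%R) _)
  jform.
Proof.
split=> [z a x y|x a y z]; rewrite /jform; first exact: l2dotP.
by rewrite linearP linearDr linearZr_LR.
Qed.

HB.instance Definition _ :=
  bilinear_isBilinear.Build _ H H _ *%R (Num.conj \; *%R) jform jform_bilinear.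

Lemma jform_hermitian x y : jform x y = (-1) ^+ false * (jform y x)^*.
Proof. by rewrite mul1r /jform -l2dot_reflection l2dotC. Qed.

HB.instance Definition _ :=
  isHermitianSesquilinear.Build _ _ false Num.conj jform jform_hermitian.

Definition even_part : {pred H} := [pred x | reflection x == x].
Definition odd_part : {pred H} := [pred x | reflection x == - x].

(** Closedness of the eigenspaces, where the form is definite, is inherited from
    the coordinates: each coordinate of J l - a l is dominated by the distance
    from l to an eigenvector. *)
Lemma hilbert_eigen (a : R[i]) (S : {pred H}) (h : H -> H -> R[i]) :
  `|a| = 1 -> (forall x, (x \in S) = (reflection x == a *: x)) ->
  {in S &, forall x y, h x y = l2dot x y} -> hilbert_on h S.
Proof.
move=> a1 SE hE.
have SS : submod_closed S.
  split; first by rewrite SE linear0 scaler0.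
  move=> b x y; rewrite !SE linearP => /eqP -> /eqP ->.
  by rewrite scalerDr !scalerA mulrC.
have subS x y : x \in S -> y \in S -> x - y \in S.
  by move=> xS yS; rewrite -scaleN1r addrC; exact: SS.2.
have nE x : x \in S -> form_norm h x = form_norm l2dot x.
  by move=> xS; rewrite /form_norm hE.
split=> // [x xS x0|u uS uC].
  by rewrite hE // l2dot_gt0.
have [|l ul] := @l2_complete _ _ u.
  move=> e e0; have [N hN] := uC e e0; exists N => m n Nm Nn.
  by rewrite -nE ?subS ?hN.
suff lS : l \in S.
  exists l => // e e0; have [N hN] := ul e e0; exists N => n Nn.
  by rewrite nE ?subS ?hN.
rewrite SE; apply/eqP/l2_eq => i; apply/eqP; rewrite -subr_eq0.
set d := _ - _; apply: contraT => d0.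
have e0 : 0 < `|d| / 2 by rewrite divr_gt0 ?normr_gt0.
have [N hN] := ul _ e0; have {hN} := hN N (leqnn N).
rewrite form_norm_lt // => hN.
have : `|d| ^+ 2 < `|d| ^+ 2; last by rewrite ltxx.
have dE : d = a * (u N - l) i - (u N - l) (J i).
  have := uS N; rewrite SE => /eqP/(congr1 (fun x : H => x i)).
  by rewrite /d !reflectionE !(l2BE, l2ZE) => ->; ring.
rewrite {1}dE; apply: le_lt_trans (sqr_normrD_le _ _) _.
rewrite normrN normrM a1 mul1r.
have -> : `|d| ^+ 2 = (`|d| / 2) ^+ 2 *+ 2 + (`|d| / 2) ^+ 2 *+ 2 by field.
by rewrite ltrD // ltrMn2r /=; apply: le_lt_trans (l2dot_coord _ _) hN.
Qed.

Lemma even_partE x : (x \in even_part) = (reflection x == x). Proof. by []. Qed.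
Lemma odd_partE x : (x \in odd_part) = (reflection x == - x). Proof. by []. Qed.

Lemma jform_even x y : y \in even_part -> jform x y = l2dot x y.
Proof. by rewrite even_partE /jform => /eqP ->. Qed.

Lemma jform_odd x y : y \in odd_part -> jform x y = - l2dot x y.
Proof. by rewrite odd_partE /jform => /eqP ->; rewrite linearNr. Qed.

Lemma l2dot_even_odd x y : x \in even_part -> y \in odd_part -> l2dot x y = 0.
Proof.
rewrite even_partE odd_partE => /eqP xe /eqP yo.
have := l2dot_reflection x y; rewrite xe yo linearNr => /eqP.
by rewrite -addr_eq0 -mulr2n mulrn_eq0 /= => /eqP.
Qed.

Lemma reflection_fd : fundamental_decomposition jform even_part odd_part.
Proof.
split.
- apply: (@hilbert_eigen 1) => [||x y _ ye]; first exact: normr1.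
    by move=> x; rewrite scale1r.
  exact: jform_even.
- apply: (@hilbert_eigen (- 1)) => [||x y _ yo]; first by rewrite normrN1.
    by move=> x; rewrite scaleN1r.
  by rewrite jform_odd ?opprK.
- by move=> x y xe yo; rewrite jform_odd // l2dot_even_odd ?oppr0.
- move=> x; exists (2^-1 *: (x + reflection x)), (2^-1 *: (x - reflection x)); split.
  + by rewrite even_partE linearZ linearD /= reflectionK addrC.
  + by rewrite odd_partE linearZ linearB /= reflectionK -scalerN opprB.
  + rewrite -scalerDr addrACA subrr addr0 -mulr2n -(scaler_nat 2 x) scalerA.
    by rewrite mulVf ?scale1r // pnatr_eq0.
- move=> x; rewrite even_partE odd_partE => /eqP -> /eqP/(congr1 (+%R x)).
  by rewrite subrr -mulr2n -(scaler_nat 2 x) => /eqP; rewrite scaler_eq0 pnatr_eq0 => /eqP.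
Qed.

Definition reflection_krein : kreinSpace R :=
  @KreinSpace R H jform even_part odd_part reflection_fd.

(** The norm of the fundamental decomposition is the l2 norm because the
    eigenspaces are also orthogonal for the inner product of l2. *)
Lemma reflection_krein_norm (x : reflection_krein) :
  krein_norm x = form_norm l2dot (x : H).
Proof.
rewrite /krein_norm /form_norm; congr sqrtC.
have [pe po] : krein_proj x \in even_part /\ x - krein_proj x \in odd_part.
  have [y [z [ye zo xE]]] := fd_sum reflection_fd x.
  apply: (@xgetPex _ 0 [set y | y \in even_part /\ x - y \in odd_part]).
  by exists y; split=> //; rewrite xE addrC addKr.
rewrite /krein_hilbert_form; set y := krein_proj x in pe po *.
rewrite [X in X - _]jform_even // [X in _ - X]jform_odd // opprK.
have xE : (x : H) = y + (x - y) by rewrite addrC subrK.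
move: po; rewrite [in RHS]xE; move: (x - y : H) => z zo.
by rewrite linearDl !linearDr /= (l2dotC z y) (l2dot_even_odd pe zo) conjC0 addr0 add0r.
Qed.

End KreinOfInvolution.

(** * Unitary operators and adjoints *)

Section KreinOperators.
Context {R : realType} {I : choiceType}.
Variables (J : I -> I) (JK : involutive J).
Local Notation K := (reflection_krein (R := R) JK).

(** The last hypothesis says that the weights at i and at J i, which the form
    pairs together, are inverse to each other up to conjugation: the form is
    preserved although U is not an isometry of l2. *)
Lemma wcomp_unitary (w w' : I -> R[i]) (s t : I -> I) (c c' : R[i])
    (c_ge0 : 0 <= c) (c'_ge0 : 0 <= c')
    (w_le : forall i, `|w i| <= c) (w'_le : forall i, `|w' i| <= c')
    (s_inj : injective s) (t_inj : injective t) :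
  let U : {linear K -> K} := wcomp c_ge0 w_le s_inj in
  let V : {linear K -> K} := wcomp c'_ge0 w'_le t_inj in
  cancel s t -> cancel t s -> (forall i, w i * w' (s i) = 1) ->
  (forall i, s (J i) = J (s i)) -> (forall i, w i * (w (J i))^* = 1) ->
  krein_unitary U /\ (cancel U V /\ cancel V U).
Proof.
move=> U V st ts ww' sJ wJ.
have UV : cancel U V.
  move=> x; apply: l2_eq => i; rewrite !wcompE mulrA mulrC ts.
  by rewrite -[in w' i](ts i) [w' _ * _]mulrC ww' mulr1.
have VU : cancel V U.
  by move=> x; apply: l2_eq => i; rewrite !wcompE mulrA ww' mul1r st.
split=> //; split.
- by exists c => x; rewrite !reflection_krein_norm; exact: wcomp_bounded.
- by exists V.
- move=> x y; rewrite /= /jform /l2dot.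
  rewrite -(csum_reindex st ts (l2dot_summable x (reflection JK y))).
  congr csum; apply/funext => i; rewrite !reflectionE !wcompE sJ rmorphM mulrACA.
  by rewrite wJ mul1r.
Qed.

Variable p : nat.

Variable Cs : {linear 'cV[R[i]]_p -> K}.

(** Any linear C^* defined on C^p has an adjoint: its coordinates are the pairings
    with the images of the canonical basis. *)
Definition adjoint_to (x : K) : 'cV[R[i]]_p :=
  \col_j krein_form K x (Cs (delta_mx j 0)).

Lemma adjoint_to_linear : linear adjoint_to.
Proof. by move=> a x y; apply/matrixP => j k; rewrite !mxE linearPl. Qed.

HB.instance Definition _ := GRing.isLinear.Build _ _ _ _ adjoint_to adjoint_to_linear.

Lemma adjoint_toP : krein_adjoint adjoint_to Cs.
Proof.
move=> x a; rewrite [a in RHS](matrix_sum_delta a) /cdot.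
rewrite linear_sum linear_sumr; apply: eq_bigr => j _.
by rewrite big_ord1 linearZ linearZr_LR mxE /= mulrC.
Qed.

Lemma adjoint_to_bounded : krein_out_bounded adjoint_to.
Proof.
pose N := \sum_j l2dot (Cs (delta_mx j 0)) (Cs (delta_mx j 0)).
have N0 : 0 <= N by apply: sumr_ge0 => j _; exact: l2dot_ge0.
exists (sqrtC N) => x; rewrite reflection_krein_norm /form_norm.
rewrite -sqrtCM ?nnegrE ?l2dot_ge0 // ler_sqrtC ?nnegrE ?mulr_ge0 ?l2dot_ge0 //; last first.
  by apply: sumr_ge0 => j _; rewrite -normCK exprn_ge0.
rewrite mulr_suml; apply: ler_sum => j _; rewrite -normCK mxE /= mulrC.
rewrite /jform -l2dot_reflection; apply: le_trans (l2dot_CauchySchwarz _ _) _.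
by rewrite l2dot_reflection reflectionK.
Qed.

End KreinOperators.

(** * From moments to the representation of f *)

Section Realization.
Context {R : realType} {p : nat}.
Implicit Types (f : nat -> nat -> 'M[R[i]]_p) (a b : 'cV[R[i]]_p).

Lemma cdotE a b : cdot a b = (b^t* *m a) 0 0.
Proof. by rewrite mxE; apply: eq_bigr => i _; rewrite !mxE mulrC. Qed.

Lemma cdot_conj a b : cdot a b = (cdot b a)^*.
Proof.
by rewrite /cdot rmorph_sum; apply: eq_bigr => i _; rewrite rmorphM /= conjCK mulrC.
Qed.

Lemma cdot_mulmx (A : 'M[R[i]]_p) a b : cdot (A *m a) b = cdot a (A^t* *m b).
Proof.
by rewrite !cdotE trmx_mul map_mxM map_trmx trmxK map_mxCK mulmxA.
Qed.

Lemma cdotP c a a' b : cdot (c *: a + a') b = c * cdot a b + cdot a' b.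
Proof. by rewrite !cdotE linearP !mxE. Qed.

Lemma cdotZ c a b : cdot (c *: a) b = c * cdot a b.
Proof. by rewrite !cdotE linearZ mxE. Qed.

Lemma cdot_inj a a' : (forall b, cdot a b = cdot a' b) -> a = a'.
Proof.
move=> aa'; apply/matrixP => j k; rewrite (ord1 k).
have dE (v : 'cV[R[i]]_p) : cdot v (delta_mx j 0) = v j 0.
  rewrite /cdot (bigD1 j) //= big1 => [|i ij].
    by rewrite mxE !eqxx conjC1 mulr1 addr0.
  by rewrite mxE (negPf ij) conjC0 mulr0.
by rewrite -!dE.
Qed.

(** The k-th power of (E - i) / sqrt 2 applied to f(0,.), taken at n, for E the
    shift of sequences: the value that C U^k B^n C^* is forced to have, since
    U = (B - i) / sqrt 2. *)
Fixpoint iterated_moment f k n : 'M[R[i]]_p :=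
  if k is k'.+1 then
    (sqrtC 2)^-1 *: (iterated_moment f k' n.+1 - 'i *: iterated_moment f k' n)
  else f 0%N n.

Variables (K : kreinSpace R) (U V : {linear K -> K}).
Hypotheses (UV : cancel U V) (VU : cancel V U).
Hypothesis U_form : forall x y, krein_form K (U x) (U y) = krein_form K x y.

Definition forward (x : K) : K := sqrtC 2 *: U x + 'i *: x.
Definition backward (x : K) : K := sqrtC 2 *: V x - 'i *: x.

Let sqrt2 : sqrtC 2 * sqrtC 2 = 2 :> R[i].
Proof. by rewrite -expr2 sqrtCK. Qed.

(** The recurrence of discrete analyticity at the level of operators. *)
Lemma backward_forward x :
  backward (forward x) = x + 'i *: backward x - 'i *: forward x.
Proof.
rewrite /backward /forward linearD !linearZ /= UV.
rewrite !scalerDr !scalerA sqrt2 (mulrC 'i (sqrtC 2)).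
rewrite -['i * 'i]expr2 sqrCi scaleN1r opprK (scaler_nat 2) mulr2n.
by rewrite -[x + x + _]addrA [x + _ *: _]addrC.
Qed.

Lemma form_backward x y : krein_form K (backward x) y = krein_form K x (forward y).
Proof.
have VE z : krein_form K (V z) y = krein_form K z (U y) by rewrite -U_form VU.
rewrite /backward /forward linearBl linearDr !linearZl_LR !linearZr_LR /= VE.
rewrite conjCi mulNr; congr (_ * _ - _); apply/esym/CrealP.
by apply: ger0_real; rewrite sqrtC_ge0 ler0n.
Qed.

Variables (C : K -> 'cV[R[i]]_p) (Cs : 'cV[R[i]]_p -> K).
Hypothesis CsP : krein_adjoint C Cs.
Variable f : nat -> nat -> 'M[R[i]]_p.
Hypotheses (f_da : discrete_analytic f) (f_sym : symmetric_da f).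
Hypothesis moments : forall k a b,
  krein_form K (iter k U (Cs a)) (Cs b) = cdot (iterated_moment f k 0 *m a) b.

Lemma iter_forwardS k x :
  iter k U (forward x) = sqrtC 2 *: iter k.+1 U x + 'i *: iter k U x.
Proof. by elim: k => //= k ->; rewrite linearD !linearZ. Qed.

Lemma form_iter_forward k n a b :
  krein_form K (iter k U (iter n forward (Cs a))) (Cs b)
  = cdot (iterated_moment f k n *m a) b.
Proof.
elim: n k => [|n IH] k; first exact: moments.
rewrite [iter n.+1 _ _]/= iter_forwardS linearDl !linearZl_LR /= -(iterS k U) !IH /=.
rewrite -scalemxAl !cdotE linearZ /= mxE mulVKf; last by rewrite sqrtC_eq0 pnatr_eq0.
by rewrite mulmxBl linearB /= -scalemxAl linearZ /= !mxE subrK.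
Qed.

Lemma form_iter_backward m x y :
  krein_form K (iter m backward x) y = krein_form K x (iter m forward y).
Proof. by elim: m y => //= m IH y; rewrite form_backward IH -iterSr. Qed.

(** The boundary m = 0 is given by the moments and the boundary n = 0 by
    symmetry, backward being the adjoint of forward; the interior follows since
    both sides obey the same recurrence, whose corner value is determined by the
    three others. *)
Lemma realization m n a :
  f m n *m a = C (iter m backward (iter n forward (Cs a))).
Proof.
apply: cdot_inj => b; rewrite CsP.
have backwardP j c x y :
    iter j backward (c *: x + y) = c *: iter j backward x + iter j backward y.
  elim: j => //= j ->; rewrite /backward linearP !scalerDr scalerN !scalerA.
  by rewrite opprD addrACA (mulrC c (sqrtC 2)) (mulrC c 'i).
elim: m n => [|m IH] n; first by have /= -> := form_iter_forward 0 n a b.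
elim: n => [|n IHn].
  rewrite form_iter_backward hermC /= mul1r.
  have /= -> := form_iter_forward 0 m.+1 b a.
  rewrite f_sym -cdot_conj cdot_mulmx.
  by rewrite map_trmx trmxK map_mxCK.
have -> : f m.+1 n.+1 = 'i *: f m.+1 n + (- 'i *: f m n.+1 + f m n).
  apply/eqP; rewrite eq_sym -subr_eq0 scaleNr addrA [_ + f m n]addrC addrA.
  by rewrite f_da.
rewrite !mulmxDl -!scalemxAl !cdotP.
pose x := iter n forward (Cs a).
have -> : iter m.+1 backward (iter n.+1 forward (Cs a)) =
    'i *: iter m.+1 backward x + (- 'i *: iter m backward (iter n.+1 forward (Cs a))
                                  + iter m backward x).
  rewrite [iter m.+1 _ (iter _ _ _)]iterSr iterS -/x backward_forward.
  by rewrite iterSr -!backwardP -scaleNr -addrA addrC -addrA.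
move: (IH n) (IH n.+1) IHn; rewrite -/x; move: (iter m.+1 _ _) (iter m _ _) (iter m _ _).
by move=> u v w -> -> ->; rewrite !linearDl !linearZl_LR.
Qed.

End Realization.

(** * Geometric growth of the moments *)

Section Growth.
Context {R : realType} {p : nat}.
Variable f : nat -> nat -> 'M[R[i]]_p.

(** Unconditional convergence at one point (0, nu) with nu > 0 bounds the terms
    f(0,n) nu^n: outside of a finite set, adding a single term moves a partial sum
    that is already within 1 of the limit. *)
Lemma gen_fun_growth : gen_fun_cvg f ->
  exists M q : R[i], [/\ 0 <= M, 0 <= q & forall n i j, `|f 0%N n i j| <= M * q ^+ n].
Proof.
move=> /nbhs_ballP[e /= e0 he].
pose nu : R[i] := e / 2.
have nu0 : 0 < nu by rewrite divr_gt0.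
have {he} : cvg (partial_sum (gen_term f 0 nu) @ totally).
  apply: (he (0, nu)); split; rewrite /= /ball /= sub0r normrN ?normr0 //.
  by rewrite gtr0_norm // ltr_pdivrMr // mulr2n mulrDr mulr1 ltrDl.
move/cvg_ex => [l ul].
have [A _ hA] := ul _ (nbhsx_ballx l 1 ltr01).
pose u := gen_term f 0 nu.
have psE B : partial_sum u B = \sum_(k <- B) u k.
  by rewrite /partial_sum (big_seq_fsetE _ B predT).
have near_l B : (A `<=` B)%fset -> forall i j,
    `|l i j - (\sum_(k <- B) u k) i j| < 1.
  by move=> AB i j; have := hA B AB; rewrite /= psE => -[_ /(_ i j)].
pose M : R[i] := 2 + \sum_i \sum_j \sum_(k <- A) `|u k i j|.
have S0 (i j : 'I_p) : 0 <= \sum_(k <- A) `|u k i j| by exact: sumr_ge0.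
have SM i j : \sum_(k <- A) `|u k i j| <= \sum_i \sum_j \sum_(k <- A) `|u k i j|.
  rewrite (bigD1 i) //= (bigD1 j) //= -addrA lerDl addr_ge0 ?sumr_ge0 // => i' _.
  exact: sumr_ge0.
have uM n i j : `|u (0%N, n) i j| <= M.
  have [nA|nA] := boolP ((0%N, n) \in A).
    apply: (@le_trans _ _ (\sum_(k <- A) `|u k i j|)).
      by rewrite (big_fsetD1 _ nA) /= lerDl sumr_ge0.
    by apply: le_trans (SM i j) _; rewrite lerDr.
  apply: (@le_trans _ _ 2); last by rewrite lerDl (le_trans (S0 i j)).
  pose B := ((0%N, n) |` A)%fset.
  have -> : u (0%N, n) i j = (l i j - (\sum_(k <- A) u k) i j)
      - (l i j - (\sum_(k <- B) u k) i j).
    have cancelE (a b c : R[i]) : a = b - c - (b - (a + c)) by ring.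
    have -> : (\sum_(k <- B) u k) i j = u (0%N, n) i j + (\sum_(k <- A) u k) i j.
      by rewrite big_fsetU1 //= mxE.
    exact: cancelE.
  apply: le_trans (ler_normB _ _) _; rewrite -[2]/(1 + 1 : R[i]).
  by rewrite lerD // ltW ?near_l // fsubsetU1.
exists M, nu^-1; split.
- by rewrite addr_ge0 // sumr_ge0 // => i _; rewrite sumr_ge0.
- by rewrite invr_ge0 ltW.
move=> n i j; rewrite exprVn ler_pdivlMr ?exprn_gt0 // mulrC.
have nuJ : nu^* = nu by apply/CrealP/gtr0_real.
have uE : u (0%N, n) i j = nu ^+ n * f 0%N n i j.
  by rewrite /u /gen_term /= expr0 mul1r mxE nuJ.
by have := uM n i j; rewrite uE normrM (ger0_norm (exprn_ge0 n (ltW nu0))).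
Qed.

Lemma iterated_moment_growth (M q : R[i]) : 0 <= M -> 0 <= q ->
  (forall n i j, `|f 0%N n i j| <= M * q ^+ n) ->
  forall k n i j, `|iterated_moment f k n i j| <= M * q ^+ n * (q + 1) ^+ k.
Proof.
move=> M0 q0 fM; elim=> [|k IH] n i j; first by rewrite expr0 mulr1; exact: fM.
have s1 : 1 <= sqrtC 2 :> R[i].
  by rewrite -[leLHS]sqrtC1 ler_sqrtC ?nnegrE ?ler1n.
have s0 : 0 < sqrtC 2 :> R[i] by exact: lt_le_trans s1.
rewrite /= !mxE normrM ger0_norm ?invr_ge0 ?(ltW s0) //.
rewrite mulrC ler_pdivrMr //; apply: le_trans (ler_normB _ _) _.
rewrite normrM normCi mul1r.
apply: (@le_trans _ _ (M * q ^+ n * (q + 1) ^+ k.+1)); last first.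
  by rewrite ler_peMr // !mulr_ge0 ?exprn_ge0 ?addr_ge0.
apply: le_trans (lerD (IH _ _ _) (IH _ _ _)) _.
rewrite [leRHS](_ : _ = M * q ^+ n.+1 * (q + 1) ^+ k + M * q ^+ n * (q + 1) ^+ k) //.
by rewrite !exprS; ring.
Qed.

End Growth.

(** * The bilateral weighted shift model *)

Section Model.
Context {R : realType} {p : nat}.

(** The Boolean selects one of the two copies of l2(Z, C^p). *)
Definition krein_index : choiceType := (bool * int * 'I_p)%type.
Implicit Types (a b : 'cV[R[i]]_p) (x y : l2 R krein_index).

Definition flip (i : krein_index) : krein_index := (~~ i.1.1, i.1.2, i.2).
Definition shift_right (i : krein_index) : krein_index := (i.1.1, i.1.2 + 1, i.2).
Definition shift_left (i : krein_index) : krein_index := (i.1.1, i.1.2 - 1, i.2).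

Lemma flipK : involutive flip.
Proof. by case=> [[c l] j]; rewrite /flip /= negbK. Qed.

Lemma shift_leftK : cancel shift_left shift_right.
Proof. by case=> [[c l] j]; rewrite /shift_right /shift_left /= subrK. Qed.

Lemma shift_rightK : cancel shift_right shift_left.
Proof. by case=> [[c l] j]; rewrite /shift_right /shift_left /= addrK. Qed.

Lemma geometric_sum_le2 N : \sum_(n < N) (2^-1 : R[i]) ^+ n <= 2.
Proof.
suff -> : \sum_(n < N) (2^-1 : R[i]) ^+ n = 2 - 2 * 2^-1 ^+ N.
  by rewrite gerBl mulr_ge0 ?exprn_ge0 ?invr_ge0.
elim: N => [|N IH]; first by rewrite big_ord0 expr0 mulr1 subrr.
by rewrite big_ord_recr IH exprS mulrA mulfV ?pnatr_eq0 //=; ring.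
Qed.

Lemma sq_summable_decay (x : krein_index -> R[i]) (M : R[i]) :
  (forall c l j, `|x (c, l, j)| ^+ 2 <= M * 2^-1 ^+ absz l) -> sq_summable x.
Proof.
move=> xM.
exists (\sum_(k : bool * bool * 'I_p) M * 2) => A.
(* An index of A is described by a sign, a size below N + 1, a copy and a coordinate;
   zero is reached with both signs, which only weakens the bound. *)
pose N := \sum_(i <- A) absz i.1.2.
pose f (t : bool * bool * 'I_p * 'I_N.+1) : krein_index :=
  (t.1.1.1, if t.1.1.2 then Posz t.2 else - Posz t.2, t.1.2).
pose h (i : krein_index) : bool * bool * 'I_p * 'I_N.+1 :=
  (i.1.1, 0 <= i.1.2, i.2, inord (absz i.1.2)).
have fh : {in A, cancel h f}.
  move=> [[c l] j] iA; rewrite /f /h /= inordK.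
    by case: l {iA} => n //=; rewrite NegzE.
  by rewrite ltnS /N (big_fsetD1 _ iA) /= leq_addr.
have -> : \sum_(i <- A) `|x i| ^+ 2 = \sum_(t <- map h A) `|x (f t)| ^+ 2.
  by rewrite big_map; apply: eq_big_seq => i iA; rewrite /= fh.
rewrite big_uniq /=; last by rewrite (map_inj_in_uniq (can_in_inj fh)) fset_uniq.
apply: (@le_trans _ _ (\sum_t `|x (f t)| ^+ 2)).
  rewrite [leRHS](bigID (mem (map h A))) /= lerDl.
  by apply: sumr_ge0 => t _; rewrite exprn_ge0.
apply: (@le_trans _ _ (\sum_(k : bool * bool * 'I_p) \sum_(n < N.+1) M * 2^-1 ^+ n)).
  rewrite pair_bigA /=; apply: ler_sum => -[[[c sg] j] n] _; rewrite /f /=.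
  by apply: le_trans (xM _ _ _) _; case: sg; rewrite ?abszN.
apply: ler_sum => -[[c sg] j] _; rewrite -mulr_sumr ler_wpM2l ?geometric_sum_le2 //.
by have := xM c 0 j; rewrite expr0 mulr1; apply: le_trans; exact: exprn_ge0.
Qed.

Variables (d : nat -> 'M[R[i]]_p) (M r : R[i]).
Hypotheses (M_ge0 : 0 <= M) (r_gt0 : 0 < r).
Hypothesis d_le : forall n i j, `|d n i j| <= M * (r / 2) ^+ n.

Definition delta_part a (i : krein_index) : R[i] :=
  if i.1.1 then (i.1.2 == 0)%:R * a i.2 0 else 0.

Definition tail_part a (i : krein_index) : R[i] :=
  if i.1.1 then 0 else
  if i.1.2 is Posz n then r ^- n * ((d n)^t* *m a) i.2 0 else 0.

Lemma delta_part_l2 a : delta_part a \in l2_pred.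
Proof.
apply/asboolP; apply: (@sq_summable_decay _ (\sum_j `|a j 0| ^+ 2)) => c l j.
have S0 : 0 <= \sum_j `|a j 0| ^+ 2 by apply: sumr_ge0 => k _; exact: exprn_ge0.
rewrite /delta_part /=; case: c; last first.
  by rewrite normr0 expr0n mulr_ge0 // exprn_ge0 ?invr_ge0.
have [->|_] := eqVneq l 0; last first.
  by rewrite mul0r normr0 expr0n mulr_ge0 // exprn_ge0 ?invr_ge0.
rewrite mul1r expr0 mulr1 (bigD1 j) //= lerDl.
by apply: sumr_ge0 => k _; rewrite exprn_ge0.
Qed.

Lemma tail_part_l2 a : tail_part a \in l2_pred.
Proof.
pose S := \sum_k `|a k 0|; have S0 : 0 <= S by exact: sumr_ge0.
apply/asboolP; apply: (@sq_summable_decay _ ((M * S) ^+ 2)) => c l j.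
have MS0 : 0 <= M * S by exact: mulr_ge0.
rewrite /tail_part /=; case: c.
  by rewrite normr0 expr0n mulr_ge0 // exprn_ge0 ?invr_ge0.
case: l => n; last by rewrite normr0 expr0n mulr_ge0 // exprn_ge0 ?invr_ge0.
have rn0 : 0 < r ^+ n by rewrite exprn_gt0.
have : `|r ^- n * ((d n)^t* *m a) j 0| <= M * S * 2^-1 ^+ n.
  rewrite normrM normfV (gtr0_norm rn0) mulrC ler_pdivrMr // mxE.
  apply: le_trans (ler_norm_sum _ _ _) _.
  rewrite (_ : _ * r ^+ n = \sum_k M * (r / 2) ^+ n * `|a k 0|).
    apply: ler_sum => k _; rewrite normrM !mxE norm_conjC ler_wpM2r //.
  by rewrite -mulr_sumr -/S expr_div_n exprVn; ring.
move=> le1; apply: (@le_trans _ _ ((M * S * 2^-1 ^+ n) ^+ 2)).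
  by rewrite ler_pXn2r ?nnegrE ?mulr_ge0 ?exprn_ge0 ?invr_ge0.
rewrite exprMn ler_wpM2l ?exprn_ge0 //= expr2.
by rewrite ler_piMl ?exprn_ge0 ?exprn_ile1 ?invr_ge0 // invf_le1 ?ler1n.
Qed.

(** The delta in the first copy generates all positive shifts; pairing it with the
    tail in the second copy reads off the prescribed matrices. *)
Definition cstar a : l2 R krein_index := L2 (delta_part_l2 a) + L2 (tail_part_l2 a).

Lemma cstarE a i : cstar a i = delta_part a i + tail_part a i. Proof. by []. Qed.

Lemma cstar_linear : linear cstar.
Proof.
move=> c a b; apply: l2_eq => -[[e l] j].
rewrite !(l2DE, l2ZE, cstarE) /delta_part /tail_part /=.
case: e; first by rewrite !mxE; ring.
case: l => n; last by ring.
by rewrite linearP !mxE; ring.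
Qed.

HB.instance Definition _ := GRing.isLinear.Build _ _ _ _ cstar cstar_linear.

Definition weight (i : krein_index) : R[i] := if i.1.1 then r else r^-1.

Local Notation K := (reflection_krein (R := R) flipK).

Hypothesis r_ge1 : 1 <= r.

Lemma weight_le i : `|weight i| <= r.
Proof.
have rV : r^-1 <= r by apply: (@le_trans _ _ 1); rewrite ?invf_le1.
by rewrite /weight; case: ifP; rewrite ger0_norm ?invr_ge0 ?(ltW r_gt0).
Qed.

Lemma weight_inv_le i : `|(weight i)^-1| <= r.
Proof.
have rV : r^-1 <= r by apply: (@le_trans _ _ 1); rewrite ?invf_le1.
by rewrite /weight; case: ifP; rewrite ?invrK ger0_norm ?invr_ge0 ?(ltW r_gt0).
Qed.

Definition bishift : {linear K -> K} :=
  wcomp (ltW r_gt0) weight_le (can_inj shift_leftK).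
Definition bishift_inv : {linear K -> K} :=
  wcomp (ltW r_gt0) weight_inv_le (can_inj shift_rightK).

Lemma bishift_unitary :
  krein_unitary bishift /\ (cancel bishift bishift_inv /\ cancel bishift_inv bishift).
Proof.
have r0 : r != 0 by rewrite gt_eqF.
apply: wcomp_unitary.
- exact: shift_leftK.
- exact: shift_rightK.
- by move=> [[[] l] j]; rewrite /weight /= mulfV ?invr_eq0.
- by move=> [[c l] j].
- have rJ : r^* = r by apply/CrealP/gtr0_real.
  by move=> [[[] l] j]; rewrite /weight /= ?fmorphV /= rJ ?mulfV ?mulVf.
Qed.

Lemma iter_bishiftE k (x : K) c l j :
  (iter k bishift x : l2 R krein_index) (c, l, j) =
  weight (c, l, j) ^+ k * (x : l2 R krein_index) (c, l - Posz k, j).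
Proof.
elim: k l => [|k IH] l; first by rewrite expr0 mul1r subr0.
by rewrite iterS wcompE IH exprS mulrA -addrA -opprD.
Qed.

(** When x and the mirror image of y only meet over one fiber, their pairing is a
    finite sum; the pairings that define the moments are all of this kind. *)
Lemma jform_slice (x y : l2 R krein_index) c l :
  (forall i, i.1 != (c, l) -> x i = 0 \/ y (flip i) = 0) ->
  jform flipK x y = \sum_j x (c, l, j) * (y (~~ c, l, j))^*.
Proof.
move=> xy0; rewrite /jform /l2dot.
have -> : (fun i => x i * (reflection flipK y i)^*) = (fun i => x i * (y (flip i))^*).
  by apply/funext => i; rewrite reflectionE.
rewrite (@csum_fin _ _ _ [fset (c, l, j) | j in 'I_p]%fset) => [|[cl j] nj].
  rewrite big_imfset /=; last by move=> j k _ _ [].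
  by rewrite big_enum /=; apply: eq_bigr.
have [|->|->] := xy0 (cl, j); rewrite ?mul0r ?conjC0 ?mulr0 //.
by apply: contra nj => /eqP /= ->; apply/imfsetP; exists j.
Qed.

Hypothesis d0_herm : (d 0%N)^t* = d 0%N.

(** At k = 0 both copies contribute d_0 once, as d_0 is Hermitian; at k > 0 the
    shifted tail has left the origin and only the pairing of U^k delta_0 with the
    tail remains. *)
Lemma bishift_moments k a b :
  jform flipK (iter k bishift (cstar a : K)) (cstar b) =
  cdot (((if k == 0%N then 2 else 1) *: d k) *m a) b.
Proof.
have rJ : r^* = r by apply/CrealP/gtr0_real.
have r0 : r != 0 by rewrite gt_eqF.
rewrite {2}/cstar linearDr /=.
rewrite (@jform_slice _ _ false 0); last first.
  move=> [[[] l] j] /= i0; right; rewrite /delta_part //=.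
  by move: i0; rewrite xpair_eqE /= => /negPf ->; rewrite mul0r.
rewrite (@jform_slice _ _ true (Posz k)); last first.
  move=> [[[] l] j] /= i0; last by right.
  left; rewrite iter_bishiftE cstarE /delta_part /tail_part /= subr_eq0.
  by move: i0; rewrite xpair_eqE /= => /negPf ->; rewrite mul0r addr0 mulr0.
have -> : \sum_j (iter k bishift (cstar a : K) : l2 R krein_index) (true, Posz k, j) *
    (L2 (tail_part_l2 b) (false, Posz k, j))^* = cdot (d k *m a) b.
  rewrite cdot_mulmx; apply: eq_bigr => j _.
  rewrite iter_bishiftE cstarE /delta_part /tail_part /weight /= subrr eqxx mul1r addr0.
  by rewrite rmorphM fmorphV rmorphXn /= rJ mulrACA mulfV ?expf_neq0 // mul1r.
have -> : \sum_j (iter k bishift (cstar a : K) : l2 R krein_index) (false, 0, j) *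
    (L2 (delta_part_l2 b) (true, 0, j))^* = (k == 0%N)%:R * cdot (d k *m a) b.
  rewrite mulr_sumr; apply: eq_bigr => j _.
  rewrite iter_bishiftE cstarE /delta_part /tail_part /weight /= !mul1r add0r.
  case: k => [|k]; last by rewrite sub0r !(mulr0, mul0r).
  by rewrite subr0 expr0 !mul1r d0_herm [r ^- 0]invr1 mul1r.
rewrite -scalemxAl cdotZ.
by case: eqP => _ /=; ring.
Qed.

End Model.

Theorem theorem3p5 (R : realType) (p : nat) (f : nat -> nat -> 'M[R[i]]_p)
    (f_da : discrete_analytic f) (f_sym : symmetric_da f)
    (f_cvg : gen_fun_cvg f) :
  exists (K : kreinSpace R) (U Uinv : {linear K -> K})
      (C : {linear K -> 'cV[R[i]]_p}) (Cstar : {linear 'cV[R[i]]_p -> K}),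
    [/\ krein_unitary U,
        cancel U Uinv /\ cancel Uinv U,
        krein_out_bounded C,
        krein_adjoint C Cstar
      & forall (m n : nat) (a : 'cV[R[i]]_p),
          f m n *m a =
          C (iter m (fun x : K => sqrtC 2 *: Uinv x - 'i *: x)
              (iter n (fun x : K => sqrtC 2 *: U x + 'i *: x) (Cstar a)))].
Proof.
have [M [q [M0 q0 fM]]] := gen_fun_growth f_cvg.
have cM := iterated_moment_growth M0 q0 fM.
(* d_0 is halved because it enters the zeroth moment twice. *)
pose d (k : nat) :=
  if k == 0%N then 2^-1 *: iterated_moment f 0 0 else iterated_moment f k 0.
(* A margin of 2 over the growth rate q + 1 makes the tail decay like 2^-n. *)
pose r : R[i] := (q + 1) * 2.
have r2 : r / 2 = q + 1 by rewrite mulfK ?pnatr_eq0.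
have q1 : 1 <= q + 1 by rewrite lerDr.
have r1 : 1 <= r.
  by apply: (le_trans q1); rewrite ler_peMr ?ler1n // (le_trans _ q1).
have r0 : 0 < r by exact: lt_le_trans r1.
have d_le n i j : `|d n i j| <= M * (r / 2) ^+ n.
  rewrite r2 /d; have := cM n 0%N i j; rewrite expr0 mulr1.
  case: eqP => [->|//]; rewrite expr0 mulr1 mxE normrM => le1.
  apply: le_trans le1; rewrite ler_piMl // ger0_norm ?invr_ge0 //.
  by rewrite invf_le1 ?ler1n.
have d0 : (d 0%N)^t* = d 0%N.
  rewrite /d /= linearZ map_mxZ /= -f_sym.
  by congr (_ *: _); apply/CrealP/ger0_real; rewrite invr_ge0.
have [U_unitary [UV VU]] := @bishift_unitary R p r r0 r1.
pose Cs : {linear 'cV[R[i]]_p -> reflection_krein (R := R) (@flipK p)} :=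
  cstar M0 r0 d_le.
exists (reflection_krein (@flipK p)), (bishift r0 r1), (bishift_inv r0 r1),
  (adjoint_to Cs), Cs.
split=> //; [exact: adjoint_to_bounded | exact: adjoint_toP | move=> m n a].
apply: (realization UV VU (unitary_form U_unitary) (adjoint_toP Cs) f_da f_sym).
move=> k {}a b; have := bishift_moments M0 r0 d_le r1 d0 k a b => /= ->.
congr (cdot (_ *m _) _); rewrite /d; case: eqP => [->|_]; last by rewrite scale1r.
by rewrite scalerA mulfV ?scale1r ?pnatr_eq0.
Qed.
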